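(* For every integer $n \ge 2$, there exists an infinite set $\mathcal{K}_n$ of positive integers such that for all $k \in \mathcal{K}_n$ the quotient group $\mathrm{Out}(F_n)/\mathfrak{G}_{n,k}$ contains infinite-order elements.
   Context: $F_n$ is the free group on $n$ generators and $\mathrm{Out}(F_n)$ is its outer automorphism group. Given a free basis $S$ of $F_n$ and distinct elements $x,y \in S$, the transvection $\tau_{S,x,y}\colon F_n \to F_n$ is the automorphism defined by $\tau_{S,x,y}(x) = yx$ and $\tau_{S,x,y}(z) = z$ for all $z \in S$ with $z \neq x$. For $k \ge 1$, $\mathfrak{G}_{n,k}$ is the subgroup of $\mathrm{Out}(F_n)$ generated by the $k$-th powers of (the images in $\mathrm{Out}(F_n)$ of) all transvections, ranging over all free bases $S$ and all distinct $x,y \in S$; this subgroup is normal. *)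

(* Defs.v *)
From HB Require Import structures.
From mathcomp Require Import all_boot.
From mathcomp Require Import boolp classical_sets cardinality.

Set Implicit Arguments.
Unset Strict Implicit.
Unset Printing Implicit Defensive.

Local Open Scope classical_set_scope.
Local Open Scope group_scope.

(* Free groups: reduced words.  The letter (x, true) stands for x and
   (x, false) for its inverse. *)

Section FreeGroup.
Context (X : choiceType).
Implicit Types (a : X * bool) (s t u : seq (X * bool)).

Definition linv a : X * bool := (a.1, ~~ a.2).

Definition reduced s := sorted (fun a b => b != linv a) s.

Definition push a s :=
  if s is b :: s' then if b == linv a then s' else a :: s else [:: a].

Definition wmul s t := foldr push t s.

Definition winv s := rev (map linv s).

Lemma linvK : involutive linv.
Proof. by case=> x b; rewrite /linv /= negbK. Qed.

Lemma reduced_push a s : reduced s -> reduced (push a s).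
Proof.
case: s => //= b s hs; case: ifPn => [_|ne]; first exact: path_sorted hs.
by rewrite /= ne.
Qed.

Lemma reduced_wmul s t : reduced t -> reduced (wmul s t).
Proof. by move=> ht; elim: s => //= a s IH; apply: reduced_push. Qed.

Lemma pushK a s : reduced s -> push (linv a) (push a s) = s.
Proof.
case: s => [|b s] hs /=; first by rewrite linvK eqxx.
case: ifPn => [/eqP eb|ne] /=; last by rewrite linvK eqxx.
case: s hs => [|c s] /= hs; rewrite ?eb //.
by case/andP: hs => hc _; rewrite -eb (negPf hc).
Qed.

Lemma pushKV a s : reduced s -> push a (push (linv a) s) = s.
Proof. by move=> hs; rewrite -{1}(linvK a) pushK. Qed.

Lemma wmul_push a s t : reduced t -> wmul (push a s) t = push a (wmul s t).
Proof.
move=> ht; case: s => [|b s] //=; case: ifPn => [/eqP->|//].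
by rewrite pushKV // reduced_wmul.
Qed.

Lemma wmulA s t u : reduced u -> wmul s (wmul t u) = wmul (wmul s t) u.
Proof. by move=> hu; elim: s => //= a s ->; rewrite wmul_push. Qed.

Lemma wmuls1 s : reduced s -> wmul s [::] = s.
Proof.
elim: s => //= a s IH hs; rewrite IH; last exact: path_sorted hs.
by case: s hs {IH} => //= b s /andP[/negPf->].
Qed.

Lemma wmul_cat s t u : wmul (s ++ t) u = wmul s (wmul t u).
Proof. exact: foldr_cat. Qed.

Lemma wmulVs s t : reduced t -> wmul (winv s) (wmul s t) = t.
Proof.
move=> ht; elim: s => //= a s IH.
by rewrite /winv /= rev_cons -cats1 wmul_cat /= pushK ?IH ?reduced_wmul.
Qed.

Lemma reduced_winv s : reduced s -> reduced (winv s).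
Proof.
rewrite /reduced /winv rev_sorted sorted_map => h; apply: (sub_sorted _ h) => a b /=.
by rewrite linvK eq_sym.
Qed.

Lemma winvK : involutive winv.
Proof. by move=> s; rewrite /winv map_rev revK mapK //; apply: linvK. Qed.

Definition freegrp := {s : seq (X * bool) | reduced s}.
HB.instance Definition _ := Choice.on freegrp.

Definition fmul (s t : freegrp) : freegrp :=
  exist _ (wmul (val s) (val t)) (reduced_wmul (val s) (valP t)).
Definition fone : freegrp := exist _ [::] isT.
Definition finv (s : freegrp) : freegrp :=
  exist _ (winv (val s)) (reduced_winv (valP s)).

Lemma fmulA : associative fmul.
Proof. by move=> s t u; apply: val_inj; rewrite /= wmulA //; apply: valP. Qed.

Lemma fmul1 : left_id fone fmul.
Proof. by move=> s; apply: val_inj. Qed.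

Lemma fmulr1 : right_id fone fmul.
Proof. by move=> s; apply: val_inj; apply: wmuls1; apply: valP. Qed.

Lemma fmulV : left_inverse fone finv fmul.
Proof.
move=> s; apply: val_inj => /=.
by rewrite -{2}(wmuls1 (valP s)) wmulVs.
Qed.

Lemma fmulrV : right_inverse fone finv fmul.
Proof.
move=> s; rewrite -[X in fmul X _](_ : finv (finv s) = s) ?fmulV //.
by apply: val_inj; apply: winvK.
Qed.

HB.instance Definition _ :=
  isGroup.Build freegrp fmulA fmul1 fmulr1 fmulV fmulrV.

Definition fgen (x : X) : freegrp := exist _ [:: (x, true)] isT.

End FreeGroup.

(* S is a free basis of F: every map from S to a group H extends uniquely to a
   homomorphism.  As H is inhabited, maps from S to H are restrictions of maps
   from F to H. *)
Definition free_basis (F : groupType) (S : set F) : Prop :=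
  forall (H : groupType) (f : F -> H),
    exists! g : F -> H, {morph g : x y / x * y} /\ (forall x, S x -> g x = f x).

Lemma free_basis_ext (F H : groupType) (S : set F) (g h : F -> H) :
  free_basis S -> {morph g : x y / x * y} -> {morph h : x y / x * y} ->
  (forall x, S x -> g x = h x) -> g = h.
Proof.
by move=> Sfree gM hM gh; have [k [_ kU]] := Sfree H h; rewrite -(kU g) ?(kU h).
Qed.

Lemma fgen_free_basis (X : choiceType) : free_basis (range (@fgen X)).
Proof.
move=> H f.
pose ev (a : X * bool) := if a.2 then f (fgen a.1) else (f (fgen a.1))^-1.
pose lift s := foldr (fun a h => ev a * h) 1 s.
have evV a : ev a * ev (linv a) = 1.
  by case: a => x [] /=; rewrite /ev /= ?mulgV ?mulVg.
have lift_push a s : lift (push a s) = ev a * lift s.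
  case: s => //= b s; case: ifPn => [/eqP->|//].
  by rewrite mulgA evV mul1g.
have liftM s t : lift (wmul s t) = lift s * lift t.
  by elim: s => [|a s IH] /=; rewrite ?mul1g // lift_push IH mulgA.
exists (fun s => lift (val s)); split.
  split=> [s t|_ [x _ <-]]; first exact: liftM.
  by rewrite /= mulg1.
move=> g [gM gE].
have g1 : g 1 = 1 by apply: (@mulgI _ (g 1)); rewrite -gM !mulg1.
have gV x : g x^-1 = (g x)^-1.
  by apply: (@mulgI _ (g x)); rewrite -gM !mulgV.
apply/funext => -[s hs] /=.
elim: s hs => [|a s IH] hs; first by rewrite /= -g1; congr g; apply: val_inj.
have hs' : reduced s := path_sorted hs.
have -> : exist _ (a :: s) hs = (exist _ [:: a] isT : freegrp X) * exist _ s hs'.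
  apply: val_inj; rewrite [RHS]/=; case: s hs {IH hs'} => //= b s /andP[/negPf-> //].
rewrite gM -IH /=; congr (_ * _).
have gx x : g (fgen x) = f (fgen x) by apply: gE; exists x.
case: a {hs} => x [] /=; rewrite /ev /= -gx // -gV.
by congr g; apply: val_inj.
Qed.

Section Automorphisms.
Context (G : groupType).

Record aut := Aut {
  aut_fun :> G -> G;
  aut_inv : G -> G;
  autM : {morph aut_fun : x y / x * y};
  autK : cancel aut_fun aut_inv;
  autKV : cancel aut_inv aut_fun }.

Lemma aut_ext (f g : aut) : f =1 g -> f = g.
Proof.
case: f g => [f f' fM fK fK'] [g g' gM gK gK'] /= /funext fg; subst g.
have e : f' = g' by apply/funext => x; rewrite -{1}(gK' x) fK.
by subst g'; congr Aut; apply: Prop_irrelevance.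
Qed.

Lemma aut1 (f : aut) : f 1 = 1.
Proof. by apply: (@mulgI _ (f 1)); rewrite -autM !mulg1. Qed.

HB.instance Definition _ (f : aut) :=
  isUMagmaMorphism.Build G G f (aut1 f, @autM f).

HB.instance Definition _ := gen_eqMixin aut.
HB.instance Definition _ := gen_choiceMixin aut.

Lemma aut_mulM (f g : aut) : {morph (f \o g) : x y / x * y}.
Proof. by move=> x y /=; rewrite !autM. Qed.

(* Composition is written in the usual order: (f * g) x = f (g x). *)
Definition aut_mul (f g : aut) : aut :=
  Aut (aut_mulM f g) (can_comp (@autK f) (@autK g))
      (can_comp (@autKV g) (@autKV f)).

Definition aut_one : aut :=
  @Aut idfun idfun (fun _ _ => erefl) (fun _ => erefl) (fun _ => erefl).

Lemma aut_invM (f : aut) : {morph aut_inv f : x y / x * y}.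
Proof. exact: can2_gmulfM (@autK f) (@autKV f). Qed.

Definition aut_inverse (f : aut) : aut :=
  Aut (aut_invM f) (@autKV f) (@autK f).

Lemma aut_mulA : associative aut_mul.
Proof. by move=> f g h; apply: aut_ext. Qed.
Lemma aut_mul1 : left_id aut_one aut_mul.
Proof. by move=> f; apply: aut_ext. Qed.
Lemma aut_mulr1 : right_id aut_one aut_mul.
Proof. by move=> f; apply: aut_ext. Qed.
Lemma aut_mulV : left_inverse aut_one aut_inverse aut_mul.
Proof. by move=> f; apply: aut_ext => x /=; rewrite autK. Qed.
Lemma aut_mulrV : right_inverse aut_one aut_inverse aut_mul.
Proof. by move=> f; apply: aut_ext => x /=; rewrite autKV. Qed.

HB.instance Definition _ :=
  isGroup.Build aut aut_mulA aut_mul1 aut_mulr1 aut_mulV aut_mulrV.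

End Automorphisms.

Section Subgroups.
Context (G : groupType).

Definition is_subgroup (H : set G) : Prop :=
  [/\ H 1, forall x y, H x -> H y -> H (x * y) & forall x, H x -> H x^-1].

Definition generated (A : set G) : set G := smallest is_subgroup A.

Record normal_subgroup := NormalSubgroup {
  nsub :> G -> Prop;
  nsub_group : is_subgroup nsub;
  nsubJ : forall x y, nsub x -> nsub (x ^ y) }.

Lemma generated_subgroup (A : set G) : is_subgroup (generated A).
Proof.
split=> [|x y hx hy|x hx] H [hH AH]; have [h1 hM hV] := hH => //.
- by apply: hM; [apply: hx | apply: hy].
- by apply: hV; apply: hx.
Qed.

Lemma generatedJ (A : set G) :
  (forall x y, A x -> A (x ^ y)) ->
  forall x y, generated A x -> generated A (x ^ y).
Proof.
move=> AJ x y hx.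
have [h1 hM hV] := generated_subgroup A.
suff: [set z | generated A (z ^ y)] x by [].
apply: hx; split.
  split=> [|u v hu hv|u hu] /=; first by rewrite conj1g.
  - by rewrite conjMg; apply: hM.
  - by rewrite conjVg; apply: hV.
by move=> z Az H [_ AH]; apply: AH; apply: AJ.
Qed.

Definition generated_normal (A : set G)
    (AJ : forall x y, A x -> A (x ^ y)) : normal_subgroup :=
  NormalSubgroup (generated_subgroup A) (generatedJ AJ).

End Subgroups.

Section Quotient.
Local Open Scope quotient_scope.
Context (G : groupType) (N : normal_subgroup G).

Definition same_coset (x y : G) : bool := `[< N (x^-1 * y) >].

Lemma same_coset_equiv : equiv_class_of same_coset.
Proof.
have [h1 hM hV] := nsub_group N.
split=> [x|x y|y x z]; first by apply/asboolP; rewrite mulVg.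
- by apply/asboolP/asboolP => /hV; rewrite invgM invgK.
- move=> /asboolP h /asboolP h'; apply/asboolP.
  by rewrite -[z](mulVKg y) mulgA; apply: hM.
Qed.

Canonical same_coset_rel := EquivRelPack same_coset_equiv.

Definition quot_grp := {eq_quot same_coset}.
HB.instance Definition _ := Choice.on quot_grp.
HB.instance Definition _ := EqQuotient.on quot_grp.

Definition qproj (x : G) : quot_grp := \pi_quot_grp x.

Lemma qproj_eqP x y : qproj x = qproj y <-> N (x^-1 * y).
Proof.
by split=> [/eqquotP/asboolP//|h]; apply/eqquotP/asboolP.
Qed.

Lemma qproj_surj (q : quot_grp) : exists x, q = qproj x.
Proof. by exists (repr q); rewrite /qproj reprK. Qed.

Definition qmul (p q : quot_grp) : quot_grp := qproj (repr p * repr q).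
Definition qinv (p : quot_grp) : quot_grp := qproj (repr p)^-1.

Lemma repr_qproj x : N (x^-1 * repr (qproj x)).
Proof. by apply/qproj_eqP; rewrite /qproj reprK. Qed.

Lemma qmulE x y : qmul (qproj x) (qproj y) = qproj (x * y).
Proof.
have [h1 hM hV] := nsub_group N.
apply/esym/qproj_eqP; set x' := repr _; set y' := repr _.
have -> : (x * y)^-1 * (x' * y') = (x^-1 * x') ^ y * (y^-1 * y').
  by rewrite conjgE invgM -!mulgA mulVKg.
by apply: hM; [apply: nsubJ|]; apply: repr_qproj.
Qed.

Lemma qinvE x : qinv (qproj x) = qproj x^-1.
Proof.
have [h1 hM hV] := nsub_group N.
apply/qproj_eqP; rewrite invgK; set x' := repr _.
have -> : x' * x^-1 = (x^-1 * x') ^ x^-1 by rewrite conjgE invgK mulgA mulVKg.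
by apply: nsubJ; apply: repr_qproj.
Qed.

Lemma qmulA : associative qmul.
Proof.
move=> p q r; case: (qproj_surj p) (qproj_surj q) (qproj_surj r).
by move=> x -> [y ->] [z ->]; rewrite !qmulE mulgA.
Qed.
Lemma qmul1 : left_id (qproj 1) qmul.
Proof. by move=> p; have [x ->] := qproj_surj p; rewrite qmulE mul1g. Qed.
Lemma qmulr1 : right_id (qproj 1) qmul.
Proof. by move=> p; have [x ->] := qproj_surj p; rewrite qmulE mulg1. Qed.
Lemma qmulV : left_inverse (qproj 1) qinv qmul.
Proof. by move=> p; have [x ->] := qproj_surj p; rewrite qinvE qmulE mulVg. Qed.
Lemma qmulrV : right_inverse (qproj 1) qinv qmul.
Proof. by move=> p; have [x ->] := qproj_surj p; rewrite qinvE qmulE mulgV. Qed.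

HB.instance Definition _ :=
  isGroup.Build quot_grp qmulA qmul1 qmulr1 qmulV qmulrV.

Lemma qprojM : {morph qproj : x y / x * y}.
Proof. by move=> x y; rewrite -qmulE. Qed.
HB.instance Definition _ :=
  isUMagmaMorphism.Build G quot_grp qproj (erefl, qprojM).

End Quotient.

Section OuterAutomorphisms.
Context (G : groupType).

Definition inner : set (aut G) :=
  [set f | exists g : G, forall x, f x = g * x * g^-1].

Lemma inner_subgroup : is_subgroup inner.
Proof.
split=> [|f f' [g fE] [g' f'E]|f [g fE]].
- by exists 1 => x; rewrite invg1 mul1g mulg1.
- by exists (g * g') => x; rewrite [LHS]/= f'E fE invgM !mulgA.
- exists g^-1 => x; apply: (can_inj (@autK _ f)).
  by rewrite [LHS](autKV f) fE invgK !mulgA mulgV mul1g mulgK.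
Qed.

Lemma innerJ (f h : aut G) : inner f -> inner (f ^ h).
Proof.
case=> g fE; exists (aut_inv h g) => x.
apply: (can_inj (@autK _ h)).
by rewrite [LHS](autKV h) [LHS]fE !autM gmulfV /= !autKV.
Qed.

Definition Inn : normal_subgroup (aut G) :=
  NormalSubgroup inner_subgroup innerJ.

Definition Out : groupType := quot_grp Inn.

End OuterAutomorphisms.

Section PowerSubgroup.
Context (n : nat).

Local Notation F := (freegrp 'I_n).

(* On a free basis S containing distinct x and y, these equations determine t:
   see transvection_exists and transvection_unique. *)
Definition is_transvection (S : set F) (x y : F) (t : aut F) : Prop :=
  t x = y * x /\ (forall z, S z -> z <> x -> t z = z).

Lemma transvection_unique (S : set F) (x y : F) (t u : aut F) :
  free_basis S -> is_transvection S x y t -> is_transvection S x y u -> t = u.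
Proof.
move=> Sfree [tx tz] [ux uz]; apply: aut_ext => w; move: w.
suff -> : (t : F -> F) = u by [].
apply: (free_basis_ext Sfree (@autM _ t) (@autM _ u)) => z Sz.
by have [->|/eqP zx] := eqVneq z x; rewrite ?tx ?ux // tz ?uz.
Qed.

Lemma transvection_exists (S : set F) (x y : F) :
  free_basis S -> S x -> S y -> x <> y -> exists t, is_transvection S x y t.
Proof.
move=> Sfree Sx Sy xy.
have [g [[gM gE] _]] := Sfree F (fun z => if z == x then y * x else z).
have [h [[hM hE] _]] := Sfree F (fun z => if z == x then y^-1 * x else z).
have yx : (y == x) = false by apply/eqP => e; apply: xy.
have morphV (f : F -> F) : {morph f : u v / u * v} -> forall u, f u^-1 = (f u)^-1.
  move=> fM u; have f1 : f 1 = 1 by apply: (@mulgI _ (f 1)); rewrite -fM !mulg1.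
  by apply: (@mulgI _ (f u)); rewrite -fM !mulgV.
have gh : g \o h = idfun.
  apply: (free_basis_ext Sfree) => // [u v|z Sz] /=; first by rewrite hM gM.
  rewrite hE //; case: eqVneq => [->|/negPf zx]; last by rewrite gE ?zx.
  by rewrite gM morphV // !gE // eqxx yx mulKg.
have hg : h \o g = idfun.
  apply: (free_basis_ext Sfree) => // [u v|z Sz] /=; first by rewrite gM hM.
  rewrite gE //; case: eqVneq => [->|/negPf zx]; last by rewrite hE ?zx.
  by rewrite hM // !hE // eqxx yx mulVKg.
have gK : cancel g h by move=> z; have /(congr1 (@^~ z)) := hg.
have hK : cancel h g by move=> z; have /(congr1 (@^~ z)) := gh.
exists (Aut gM gK hK).
split=> [|z Sz /eqP/negPf zx] /=; first by rewrite gE // eqxx.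
by rewrite gE ?zx.
Qed.

Definition transvection_powers (k : nat) : set (Out F) :=
  [set q | exists (S : set F) (x y : F) (t : aut F),
     [/\ free_basis S, S x, S y, x <> y & is_transvection S x y t]
     /\ q = qproj (Inn F) t ^+ k].

Lemma free_basis_aut (S : set F) (h : aut F) :
  free_basis S -> free_basis [set h x | x in S].
Proof.
move=> Sfree H f; have [g [[gM gE] gU]] := Sfree H (f \o h).
exists (g \o aut_inv h); split.
  split=> [x y|_ [x Sx <-]] /=; first by rewrite aut_invM gM.
  by rewrite autK gE.
move=> g' [g'M g'E]; apply/funext => x /=.
have -> : g = g' \o h.
  apply: gU; split=> [u v|u Su] /=; first by rewrite gmulfM g'M.
  by rewrite g'E //; exists u.
by rewrite /= autKV.
Qed.

Lemma transvection_powersJ k (p q : Out F) :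
  transvection_powers k p -> transvection_powers k (p ^ q).
Proof.
move=> [S [x [y [t [[Sfree Sx Sy xy [tx tz]] ->]]]]].
have [h' ->] := qproj_surj q; pose h : aut F := h'^-1.
exists [set h z | z in S], (h x), (h y), (t ^ h'); split; last first.
  by rewrite [RHS](_ : _ = (qproj (Inn F) t ^ qproj (Inn F) h') ^+ k) ?conjXg ?gmulfJ.
have hK z : h' (h z) = z by exact: (autKV h').
have tJ z : (t ^ h') (h z) = h (t z) by rewrite [LHS]/= hK.
split; [exact: free_basis_aut | by exists x | by exists y | | ].
  by move/(can_inj hK).
split=> [|_ [z Sz <-] zx]; first by rewrite tJ tx gmulfM.
by rewrite tJ tz // => zx'; apply: zx; rewrite zx'.
Qed.

Definition power_subgroup (k : nat) : normal_subgroup (Out F) :=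
  generated_normal (@transvection_powersJ k).

End PowerSubgroup.

Definition infinite_order (G : groupType) (x : G) : Prop :=
  forall m, (0 < m)%N -> x ^+ m <> 1.

(* Main.v *)
Require Import Defs.
From HB Require Import structures.
From mathcomp Require Import all_boot all_order.
From mathcomp Require Import boolp classical_sets cardinality.
From mathcomp Require Import fingroup cyclic all_algebra finfield.
From mathcomp Require Import zify ring.

(** Since the [k]-th powers of the transvections are powers of their [k0]-th
    powers whenever [k0] divides [k], one exponent [k0] settles all its multiples.

    Rank at least 3.  Let [r] be a homomorphism from [F_n] to a group in which
    [r y ^ k = 1] for every primitive [y].  The [k]-th power of [x |-> y x] does
    not change [r], so [Out(F_n)/G_{n,k}] acts on the orbit of the conjugacy
    class of [r].  There is a finite 2-group [G] with a central involution [c]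
    and a map [F_n -> G] sending every primitive [y] to a [d]-th root of [c]:
    over the field [K] of order [2^d], with [d = 2^n], take unitriangular
    matrices with superdiagonal [a, a^2, a^4, ...] for [a] linear in the class
    of [y] in [H_1(F_n; Z/2)]; the [d]-th power has corner [a^(2^d - 1)], which
    is 1 for [a <> 0].  Deform this map into the wreath product of [Z] by [G] by
    a translation [v] on the first generator, with [c v = - v].  Then [r y ^ d]
    lies over [c], so [r y ^ 2d = 1], while [w = x_1^d x_0^d] goes to a nonzero
    translation.  The automorphism [x_2 |-> w x_2] therefore has infinite order:
    an element of the wreath product realising one of its powers by conjugation
    commutes with [r x_0], hence is torsion because [c] acts by [-1], whereas
    [r w] has infinite order.

    Rank 2.  Functions on primitive vectors of [Z^2] with
    [f (u + v) + f (u - v) = f u + f v] form a 3-dimensional representation of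
    [GL_2(Z)]; along [v + m u] they satisfy a recursion with characteristic
    polynomial [t^2 - t + 1], so the sixth power of every transvection acts
    trivially, but a product of two opposite transvections acts as a nontrivial
    unipotent. *)

Set Implicit Arguments.
Unset Strict Implicit.
Unset Printing Implicit Defensive.

Local Open Scope classical_set_scope.
Local Open Scope group_scope.

(** * Free groups and power subgroups *)

Lemma freegrp_ind (X : choiceType) (P : freegrp X -> Prop) :
  P 1 -> (forall x, P (fgen x)) -> (forall u v, P u -> P v -> P (u * v)) ->
  (forall u, P u -> P u^-1) -> forall w, P w.
Proof.
move=> P1 Pgen PM PV [s]; elim: s => [|[x b] s IH] hs.
  by rewrite (_ : exist _ _ _ = 1 :> freegrp X) //; apply: val_inj.
have hs' : reduced s := path_sorted hs.
have -> : exist _ ((x, b) :: s) hs =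
    (if b then fgen x else (fgen x)^-1) * exist _ s hs' :> freegrp X.
  apply: val_inj; case: b hs => hs /=; rewrite /linv /=;
    by case: s hs {IH hs'} => //= c s /andP[/negPf-> //].
by apply: PM => //; case: (b) => //; apply: PV.
Qed.

Lemma freegrp_lift (X : choiceType) (H : groupType) (h : X -> H) :
  exists r : freegrp X -> H,
    {morph r : x y / x * y} /\ forall x, r (fgen x) = h x.
Proof.
(* Only the values at the one-letter words [fgen x] matter, and there [f] returns [h x]. *)
pose f (w : freegrp X) := if val w is a :: _ then h a.1 else 1.
have [r [[rM rE] _]] := fgen_free_basis f.
by exists r; split=> // x; rewrite rE //; exists x.
Qed.

Section MorphFacts.
Variables (G H : groupType) (r : G -> H).
Hypothesis rM : {morph r : x y / x * y}.

Lemma morph1 : r 1 = 1.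
Proof. by apply: (@mulgI _ (r 1)); rewrite -rM !mulg1. Qed.

Lemma morphVg x : r x^-1 = (r x)^-1.
Proof. by apply: (@mulgI _ (r x)); rewrite -rM !mulgV morph1. Qed.

Lemma morphXg x m : r (x ^+ m) = r x ^+ m.
Proof. by elim: m => [|m IH]; rewrite ?morph1 // !expgS rM IH. Qed.

End MorphFacts.

Section TransvectionPowers.
Variables (n k : nat).
Local Notation F := (freegrp 'I_n).

(** [t] fixes [y], another element of [S], so each application contributes one more factor [y]. *)
Lemma transvectionX (S : set F) (x y : F) (t : aut F) m :
  S y -> x <> y -> is_transvection S x y t ->
  (t ^+ m) x = y ^+ m * x /\ forall z, S z -> z <> x -> (t ^+ m) z = z.
Proof.
move=> Sy xy [tx tz]; elim: m => [|m [IHx IHz]]; first by rewrite mul1g.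
rewrite expgS; split=> [|z Sz zx]; last by rewrite /= IHz ?tz.
have ty : t (y ^+ m) = y ^+ m.
  by rewrite (morphXg (@autM _ t)) tz // => /esym.
by rewrite /= IHx autM tx ty mulgA -expgSr.
Qed.

Lemma power_subgroup_ind (P : set (Out F)) :
  is_subgroup P ->
  (forall (S : set F) x y t, free_basis S -> S x -> S y -> x <> y ->
     is_transvection S x y t -> P (qproj (Inn F) (t ^+ k))) ->
  forall q, power_subgroup n k q -> P q.
Proof.
move=> Pgrp Pt q; apply; split=> // _ [S [x [y [t [[Sf Sx Sy xy txy] ->]]]]].
by rewrite -(morphXg (@qprojM _ (Inn F))); apply: Pt xy txy.
Qed.

Lemma infinite_order_qproj (f : aut F) :
  (forall m, (0 < m)%N -> ~ power_subgroup n k (qproj (Inn F) (f ^+ m))) ->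
  infinite_order (qproj (power_subgroup n k) (qproj (Inn F) f)).
Proof.
move=> hf m m0; rewrite -(morphXg (@qprojM _ _)) -(morphXg (@qprojM _ _)).
move=> /esym/qproj_eqP; rewrite invg1 mul1g; exact: hf.
Qed.

(* The classes of the automorphisms [t] with [r \o t] conjugate to [r] form a
   subgroup of [Out F], and a transvection power [t] does not even change [r],
   since [r (t x) = r (y ^+ k * x) = r x]. *)
Lemma power_subgroup_conj (H : groupType) (r : F -> H) (f : aut F) :
  {morph r : x y / x * y} ->
  (forall S y, free_basis S -> S y -> r y ^+ k = 1) ->
  power_subgroup n k (qproj (Inn F) f) ->
  exists g, forall z, r (f z) = r (g * z * g^-1).
Proof.
move=> rM rk.
pose P : set (Out F) := [set q | exists (t : aut F) (g : F),
  q = qproj (Inn F) t /\ forall z, r (t z) = r (g * z * g^-1)].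
have Pgrp : is_subgroup P.
  split=> [|_ _ [t [g [-> tg]]] [t' [g' [-> tg']]]|_ [t [g [-> tg]]]].
  - by exists 1, 1; split=> // z; rewrite invg1 mul1g mulg1.
  - exists (t * t'), (g * g'); rewrite qprojM; split=> // z.
    by rewrite /= tg !rM tg' invgM !rM !mulgA.
  - exists t^-1, g^-1; split; first by rewrite (morphVg (@qprojM _ _)).
    move=> z; rewrite -[in RHS](autKV t z) !rM tg !rM !(morphVg rM) invgK.
    by rewrite !mulgA mulVg mul1g mulgVK.
case/(power_subgroup_ind Pgrp) => [S x y t Sf Sx Sy xy txy|t [g [ft tg]]].
  exists (t ^+ k), 1; split=> // z; rewrite invg1 mul1g mulg1.
  have [tx tz] := transvectionX k Sy xy txy.
  suff rt : r \o (t ^+ k) = r by have /(congr1 (@^~ z)) := rt.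
  apply: (free_basis_ext Sf) => // [u v|s Ss] /=; first by rewrite autM rM.
  have [->|/eqP sx] := eqVneq s x; last by rewrite tz.
  by rewrite tx rM (morphXg rM) (rk S) // mul1g.
have /qproj_eqP[h hE] := esym ft.
exists (g * h) => z; rewrite -[f z](autKV t) [X in t X](hE z) tg.
by rewrite !rM !(morphVg rM) !rM invgM !mulgA.
Qed.

End TransvectionPowers.

(** * A finite group in which primitive elements are roots of an involution *)

Section UpperTriangular.
Import GRing.Theory.
Local Open Scope ring_scope.
Variables (K : pzRingType) (d : nat).
Implicit Types (M N : 'M[K]_d.+1) (m : nat -> K).

(** Leading terms for the filtration by superdiagonals: the entries above the [r]-th one are left
    free. *)
Definition superdiag r m M :=
  forall i j : 'I_d.+1, ((j < i + r)%N -> M i j = 0) /\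
    (j = (i + r)%N :> nat -> M i j = m i).

Lemma superdiagD r m m' M N :
  superdiag r m M -> superdiag r m' N ->
  superdiag r (fun i => m i + m' i) (M + N).
Proof.
move=> hM hN i j; have [M0 Mm] := hM i j; have [N0 Nm] := hN i j.
by split=> h; rewrite mxE; [rewrite M0 ?N0 ?addr0 | rewrite Mm ?Nm].
Qed.

(** On the leading superdiagonal of the product only the inner index [i + r] contributes. *)
Lemma superdiagM r s m m' M N :
  superdiag r m M -> superdiag s m' N ->
  superdiag (r + s) (fun i => m i * m' (i + r)%N) (M * N).
Proof.
move=> hM hN i j; split=> h; rewrite [M * N]/(M *m N) mxE.
  apply: big1 => l _; have [M0 _] := hM i l; have [N0 _] := hN l j.
  have [li|il] := ltnP l (i + r); first by rewrite M0 // mul0r.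
  by rewrite N0 ?mulr0 // (leq_trans h) // addnA leq_add2r.
have ltd : (i + r < d.+1)%N by have := ltn_ord j; lia.
rewrite (bigD1 (Ordinal ltd)) //= big1 ?addr0 => [|l].
  have [_ Mm] := hM i (Ordinal ltd); have [_ Nm] := hN (Ordinal ltd) j.
  by rewrite Mm // Nm //= h addnA.
rewrite -val_eqE /= neq_ltn => /orP[li|il].
  by have [M0 _] := hM i l; rewrite M0 ?mul0r.
by have [N0 _] := hN l j; rewrite N0 ?mulr0 // h addnA ltn_add2r.
Qed.

Lemma superdiagS r m M : superdiag r.+1 m M -> superdiag r (fun=> 0) M.
Proof.
move=> hM i j; have [M0 _] := hM i j.
by split=> h; apply: M0; rewrite ?h addnS ltnS // ltnW.
Qed.

Lemma superdiag1 : superdiag 0 (fun=> 1) 1.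
Proof.
move=> i j; rewrite [1]/(1%:M) mxE -val_eqE /= addn0.
by split=> [ji|->]; rewrite ?eqxx // gtn_eqF.
Qed.

Lemma superdiagX m M r : superdiag 1 m M ->
  superdiag r (fun i => \prod_(t < r) m (i + t)%N) (M ^+ r).
Proof.
move=> hM; elim: r => [|r IHr].
  rewrite expr0 => i j; have [h0 h1] := superdiag1 i j.
  by split=> // /h1 ->; rewrite big_ord0.
rewrite exprSr -addn1 => i j; have [h0 h1] := superdiagM IHr hM i j.
by split=> // /h1 ->; rewrite addn1 big_ord_recr.
Qed.

Lemma superdiag_top m M : superdiag d m M -> M = m 0%N *: delta_mx ord0 ord_max.
Proof.
move=> hM; apply/matrixP => i j; have [M0 Mm] := hM i j; rewrite !mxE.
have [i0|] := eqVneq i ord0.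
  rewrite i0 /= in M0 Mm *; have [jd|jd] := eqVneq j ord_max.
    by rewrite Mm ?jd // mulr1.
  rewrite M0 ?mulr0 // add0n ltn_neqAle -ltnS ltn_ord andbT.
  by apply: contraNneq jd => e; apply/eqP/val_inj.
rewrite -val_eqE /= -lt0n => i0; rewrite M0 ?mulr0 //.
by have := ltn_ord j; lia.
Qed.

End UpperTriangular.

(** Since 1 commutes with [x], each of the [e] squarings has a cross term of the form [y + y], even
    in a noncommutative ring. *)
Lemma expr1D_pow2 (R : nzRingType) (x : R) e : (forall y : R, y + y = 0)%R ->
  ((1 + x) ^+ (2 ^ e) = 1 + x ^+ (2 ^ e))%R.
Proof.
move=> R2; elim: e => [|e IHe]; first by rewrite !GRing.expr1.
rewrite expnSr !GRing.exprM IHe GRing.expr2 GRing.mulrDl GRing.mul1r.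
rewrite GRing.mulrDr GRing.mulr1 -GRing.expr2 GRing.addrA.
by rewrite -(GRing.addrA 1%R) R2 GRing.addr0.
Qed.

(* Each element is chosen outside the set of the subset sums of the previous ones. *)
Lemma subset_sums_neq0 (K : finFieldType) n :
  (2 ^ n <= #|K|)%N -> (forall y : K, y + y = 0)%R ->
  exists a : nat -> K, forall e : nat -> bool,
    (\sum_(i < n) a i *+ e i = 0)%R -> forall i, (i < n)%N -> e i = false.
Proof.
move=> + K2; elim: n => [|n IHn] hn; first by exists (fun=> 0)%R.
have [|a aP] := IHn; first by rewrite (leq_trans _ hn) // leq_exp2l.
pose s (e : {ffun 'I_n -> bool}) := (\sum_(i < n) a i *+ e i)%R.
have [x xs] : exists x, x \notin s @: predT.
  apply/existsP; rewrite -negb_forall; apply/negP => /forallP sK.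
  have := leq_imset_card s predT.
  have -> : #|s @: predT| = #|K| by apply: eq_card => x; rewrite sK.
  rewrite card_ffun card_bool card_ord leqNgt.
  by rewrite (leq_trans _ hn) // ltn_exp2l.
exists (fun i => if (i == n)%N then x else a i) => e.
rewrite big_ord_recr /= eqxx.
rewrite (eq_bigr (fun i : 'I_n => a i *+ e i)%R) => [|i _]; last first.
  by rewrite (ltn_eqF (ltn_ord i)).
case en: (e n) => /= h; last first.
  move=> i; rewrite ltnS leq_eqVlt => /orP[/eqP->//|].
  by apply: aP; rewrite GRing.addr0 in h.
case/negP: xs; apply/imsetP; exists [ffun i : 'I_n => e i] => //.
rewrite /s; under eq_bigr do rewrite ffunE.
by rewrite -[LHS](GRing.addr0_eq h) (GRing.addr0_eq (K2 _)).
Qed.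

(** * Unitriangular matrices with a Frobenius orbit on the superdiagonal *)

Section FrobeniusUnitriangular.
Import GRing.Theory.
Local Open Scope ring_scope.
Variables (K : finFieldType) (n : nat).
Hypothesis K2 : 2 \in [pchar K].
Local Notation d := (2 ^ n)%N.
Implicit Types (M N : 'M[K]_d.+1) (a b : K).

Let addKK (x : K) : x + x = 0.
Proof. exact: addrr_pchar2. Qed.

Let addMM M : M + M = 0.
Proof. by apply/matrixP => i j; rewrite !mxE addKK. Qed.

Definition frob_unitri a M := superdiag 1 (fun i => a ^+ (2 ^ i)) (M - 1).

Definition frob_mx a : 'M[K]_d.+1 :=
  1 + \matrix_(i, j) (a ^+ (2 ^ i) *+ (j == i.+1 :> nat)).

Lemma frob_mxP a : frob_unitri a (frob_mx a).
Proof.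
move=> i j; rewrite /frob_mx addrC addKr !mxE addn1.
by split=> [ji|->]; rewrite ?eqxx // ltn_eqF.
Qed.

(** [(M - 1) * (N - 1)] starts one superdiagonal higher, so the first superdiagonals add up, and the
    Frobenius powers are additive in characteristic 2. *)
Lemma frob_unitriM a b M N :
  frob_unitri a M -> frob_unitri b N -> frob_unitri (a + b) (M * N).
Proof.
move=> hM hN; have := superdiagD (superdiagD hM hN) (superdiagS (superdiagM hM hN)).
have -> : M - 1 + (N - 1) + (M - 1) * (N - 1) = M * N - 1.
  rewrite -[in RHS](subrK 1 M) -[in RHS](subrK 1 N).
  move: (M - 1) (N - 1) => A B.
  by rewrite mulrDl mul1r mulrDr mulr1 !addrA addrK -[RHS]addrA [RHS]addrC.
move=> h i j; have [h0 h1] := h i j; split=> // /h1->.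
by rewrite addr0 exprDn_pchar // pnatX pnatE ?K2.
Qed.

(** As [d] is a power of 2, [M ^+ d = 1 + (M - 1) ^+ d]. The last power has only a corner entry, the
    product of the [a ^+ (2 ^ i)] for [i < d]. *)
Lemma frob_unitriX a M : frob_unitri a M ->
  M ^+ d = 1 + a ^+ (2 ^ d).-1 *: delta_mx ord0 ord_max.
Proof.
move=> hM; have := superdiag_top (superdiagX d hM).
rewrite -{2}(subrK 1 M) [M - 1 + 1]addrC expr1D_pow2 // => ->.
congr (1 + _ *: _); rewrite prodrXr; congr (_ ^+ _).
by rewrite predn_exp mul1n.
Qed.

Lemma frob_unitri_exp a M : frob_unitri a M -> M ^+ (d * 2) = 1.
Proof.
move=> hM; rewrite exprM (frob_unitriX hM) -[2%N]expn1 expr1D_pow2 // expn1.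
have d0 : (0 < d)%N by rewrite expn_gt0.
rewrite expr2 -[_ * _]/(_ *m _) -scalemxAl -scalemxAr mul_delta_mx_cond.
by rewrite -val_eqE /= gtn_eqF // mulr0n !scaler0 addr0.
Qed.

End FrobeniusUnitriangular.

(** * Basis elements are nonzero modulo 2 *)

Section FreeBasisParity.
Import GRing.Theory.
Local Open Scope ring_scope.
Variables (n : nat) (K : finFieldType).
Hypothesis K2 : 2 \in [pchar K].
Local Notation F := (freegrp 'I_n).

(* [e] records the parities of the exponent sums of [w]. *)
Lemma additive_parity (w : F) : exists e : 'I_n -> bool,
  forall psi : F -> K, {morph psi : u v / (u * v)%g >-> u + v} ->
    psi w = \sum_i psi (fgen i) *+ e i.
Proof.
have psi1 (psi : F -> K) : {morph psi : u v / (u * v)%g >-> u + v} -> psi 1%g = 0.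
  by move=> psiM; apply: (addrI (psi 1%g)); rewrite -psiM mulg1 addr0.
have bb (x : K) (b c : bool) : x *+ (b (+) c) = x *+ b + x *+ c.
  by case: b c => [] []; rewrite ?addr0 ?add0r //= addrr_pchar2.
elim/freegrp_ind: w => [|j|u v [e eP] [f fP]|u [e eP]].
- exists (fun=> false) => psi psiM; rewrite psi1 // big1 //.
- exists (fun i => i == j) => psi _.
  by rewrite (bigD1 j) //= eqxx big1 ?addr0 // => i /negPf->.
- exists (fun i => e i (+) f i) => psi psiM.
  by rewrite psiM eP // fP // -big_split; apply: eq_bigr => i _; rewrite bb.
- exists e => psi psiM; rewrite -eP //; apply: (addrI (psi u)).
  by rewrite -psiM mulgV psi1 // addrr_pchar2.
Qed.

(** If [l y = 0], independence makes all exponent sums of [y] even, so every additive map to [K]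
    kills [y]; but freeness of [S] provides one with value 1 at [y]. *)
Lemma free_basis_additive_neq0 (l : F -> K) (S : set F) (y : F) :
  {morph l : u v / (u * v)%g >-> u + v} ->
  (forall e : 'I_n -> bool, \sum_i l (fgen i) *+ e i = 0 -> forall i, e i = false) ->
  free_basis S -> S y -> l y != 0.
Proof.
move=> lM lfree Sfree Sy; apply/negP => /eqP ly.
have [psi [[psiM psiS] _]] := Sfree K (fun=> 1%R).
have [e eP] := additive_parity y.
have e0 := lfree e; rewrite -eP // in e0.
have /eqP := oner_neq0 K; apply; rewrite -(psiS y) // eP // big1 // => i _.
by rewrite e0.
Qed.

End FreeBasisParity.

Lemma exists_root_group n : (0 < n)%N -> exists (G : finGroupType) (c : G) (d : nat)
    (r : freegrp 'I_n -> G),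
  [/\ (0 < d)%N, c <> 1, c * c = 1, {morph r : u v / u * v} &
      forall S y, free_basis S -> S y -> r y ^+ d = c].
Proof.
move=> n0; pose d := (2 ^ n)%N; have d0 : (0 < d)%N by rewrite expn_gt0.
have [K K2 cardK] := pPrimePowerField (isT : prime 2) d0.
have KK := GRing.addrr_pchar2 K2.
have [||a aP] := @subset_sums_neq0 K n.
- by rewrite cardK leq_exp2l // ltnW // ltn_expl.
- exact: KK.
have [l [lM lgen]] := @freegrp_lift _ (K : groupType) (fun i : 'I_n => a i).
have unitU (b : K) (M : 'M[K]_d.+1) : frob_unitri b M -> M \is a GRing.unit.
  move=> hM; rewrite -(@GRing.unitrX_pos _ _ (d * 2)) ?muln_gt0 ?d0 //.
  by rewrite (frob_unitri_exp K2 hM) GRing.unitr1.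
pose X (i : 'I_n) := FinRing.unit _ (unitU _ _ (@frob_mxP K n (a i))).
have [r [rM rgen]] := freegrp_lift X.
have rU w : frob_unitri (l w) (val (r w)).
  elim/freegrp_ind: w => [|i|u v hu hv|u hu].
  - rewrite (morph1 lM) (morph1 rM) => i j; rewrite GRing.subrr mxE.
    by split=> // _; rewrite GRing.expr0n expn_eq0.
  - by rewrite lgen rgen; apply: frob_mxP.
  - by rewrite lM rM; apply: frob_unitriM.
  (* The inverse of [r u] is its power of exponent [d * 2 - 1], so stability under products
     suffices. *)
  - have hX m : frob_unitri (l u *+ m)%R (val (r u) ^+ m)%R.
      elim: m => [i j|m IHm]; last first.
        by rewrite GRing.mulrS GRing.exprS; apply: frob_unitriM.
      rewrite GRing.mulr0n GRing.expr0 GRing.subrr mxE.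
      by split=> // _; rewrite GRing.expr0n expn_eq0.
    have dd : (d * 2).-1.+1 = (d * 2)%N by rewrite prednK // muln_gt0 d0.
    have := hX (d * 2).-1; congr frob_unitri.
      rewrite (morphVg lM); apply: (GRing.addrI (l u)).
      rewrite -GRing.mulrS dd mulnC GRing.mulrnA GRing.mulr2n KK GRing.mul0rn.
      by rewrite [RHS]mulgV.
    rewrite (morphVg rM); apply: (GRing.mulrI (valP (r u))).
    by rewrite -GRing.exprS dd (frob_unitri_exp K2 hu) GRing.mulrV ?(valP (r u)).
have rX S y : free_basis S -> S y ->
    (val (r y) ^+ d = 1 + delta_mx ord0 ord_max)%R.
  move=> Sf Sy; rewrite (frob_unitriX K2 (rU y)).
  suff -> : (l y ^+ (2 ^ d).-1 = 1)%R by rewrite GRing.scale1r.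
  have ly : l y != 0%R.
    apply: (free_basis_additive_neq0 K2 lM) Sf Sy => e e0 i.
    have /(_ _ i (ltn_ord i)) := aP (fun m => if insub m is Some j then e j else false).
    rewrite valK; apply; rewrite -[RHS]e0.
    by apply: eq_bigr => j _; rewrite lgen valK.
  (* The exponent is the order of the unit group of [K]. *)
  apply: (GRing.mulfI ly); rewrite -GRing.exprS prednK ?expn_gt0 // -cardK.
  by rewrite expf_card GRing.mulr1.
pose x0 := r (fgen (Ordinal n0)).
have cE : (val (x0 ^+ d)%g = 1 + delta_mx ord0 ord_max)%R.
  rewrite FinRing.val_unitX; apply: (rX (range (@fgen _))).
    exact: fgen_free_basis.
  by exists (Ordinal n0).
exists {unit 'M[K]_d.+1}, (x0 ^+ d), d, r; split=> //.
- move=> c1; have /matrixP/(_ ord0 ord_max) := cE.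
  rewrite c1 FinRing.val_unit1 !mxE -val_eqE /= (ltn_eqF d0) eqxx.
  by move/eqP; rewrite GRing.add0r eq_sym GRing.oner_eq0.
- rewrite -expg2 -expgnA; apply: val_inj.
  by rewrite FinRing.val_unitX (frob_unitri_exp K2 (rU _)).
- by move=> S y Sf Sy; apply: val_inj; rewrite FinRing.val_unitX (rX S) // cE.
Qed.

(** * Rank at least three *)

Section WreathProduct.
Import GRing.Theory.
Variable G : finGroupType.

(** A separate name, so that the product type can carry the semidirect multiplication
    [wreath_mul]. *)
Definition wreath := ({ffun G -> int} * G)%type.
HB.instance Definition _ := Choice.on wreath.
Implicit Types (p q : wreath) (F : {ffun G -> int}) (g : G).

Definition shift g F : {ffun G -> int} := [ffun u => F (g^-1 * u)].

Lemma shiftD g F F' : shift g (F + F')%R = (shift g F + shift g F')%R.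
Proof. by apply/ffunP => u; rewrite !ffunE. Qed.

Lemma shiftN g F : shift g (- F)%R = (- shift g F)%R.
Proof. by apply/ffunP => u; rewrite !ffunE. Qed.

Lemma shift0 g : shift g 0%R = 0%R.
Proof. by apply/ffunP => u; rewrite !ffunE. Qed.

Lemma shift1 F : shift 1 F = F.
Proof. by apply/ffunP => u; rewrite ffunE invg1 mul1g. Qed.

Lemma shiftM g g' F : shift (g * g') F = shift g (shift g' F).
Proof. by apply/ffunP => u; rewrite !ffunE invgM mulgA. Qed.

Definition wreath_mul p q : wreath := ((p.1 + shift p.2 q.1)%R, p.2 * q.2).
Definition wreath_one : wreath := (0%R, 1).
Definition wreath_inv p : wreath := ((- shift p.2^-1 p.1)%R, p.2^-1).

Lemma wreath_mulA : associative wreath_mul.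
Proof.
by move=> p q s; rewrite /wreath_mul /= shiftD shiftM addrA mulgA.
Qed.
Lemma wreath_mul1 : left_id wreath_one wreath_mul.
Proof. by case=> F g; rewrite /wreath_mul /= shift1 add0r mul1g. Qed.
Lemma wreath_mulr1 : right_id wreath_one wreath_mul.
Proof. by case=> F g; rewrite /wreath_mul /= shift0 addr0 mulg1. Qed.
Lemma wreath_mulV : left_inverse wreath_one wreath_inv wreath_mul.
Proof. by case=> F g; rewrite /wreath_mul /= addNr mulVg. Qed.
Lemma wreath_mulrV : right_inverse wreath_one wreath_inv wreath_mul.
Proof.
by case=> F g; rewrite /wreath_mul /= shiftN -shiftM mulgV shift1 addrN.
Qed.

HB.instance Definition _ := isGroup.Build wreath
  wreath_mulA wreath_mul1 wreath_mulr1 wreath_mulV wreath_mulrV.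

Lemma wreathM p q : p * q = ((p.1 + shift p.2 q.1)%R, p.2 * q.2) :> wreath.
Proof. by []. Qed.

Lemma wreath_sndM : {morph (fun p : wreath => p.2) : p q / p * q}.
Proof. by []. Qed.

Lemma wreath_sndX p m : (p ^+ m).2 = p.2 ^+ m.
Proof. exact: (morphXg wreath_sndM). Qed.

Lemma wreath_baseX F m : ((F, 1) : wreath) ^+ m = ((F *+ m)%R, 1).
Proof.
elim: m => [|m IHm]; first by rewrite expg0 mulr0n.
by rewrite expgS IHm wreathM /= shift1 mulrS mulg1.
Qed.

Lemma wreath_topX g m : ((0%R, g) : wreath) ^+ m = (0%R, g ^+ m).
Proof.
elim: m => [|m IHm]; first by rewrite expg0.
by rewrite expgS IHm wreathM /= shift0 addr0 -expgS.
Qed.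

End WreathProduct.

(** * Translations negated by an involution *)

Section AntiInvariant.
Import GRing.Theory.
Variables (G : finGroupType) (c : G).
Implicit Types p q : wreath G.

(** Commutation with [p.2] makes the sign condition on translations stable under products and
    inverses. *)
Definition anti p := shift c p.1 = (- p.1)%R /\ commute c p.2.

Lemma anti1 : anti 1.
Proof. by split; [rewrite shift0 oppr0 | exact: commute1]. Qed.

Lemma antiM p q : anti p -> anti q -> anti (p * q).
Proof.
move=> [p1 p2] [q1 q2]; split; last exact: commuteM.
by rewrite /= shiftD -shiftM p2 shiftM p1 q1 shiftN opprD.
Qed.

Lemma antiV p : anti p -> anti p^-1.
Proof.
move=> [p1 p2]; split; last exact: commuteV.
by rewrite /= shiftN -shiftM (commuteV p2) shiftM p1 shiftN opprK.
Qed.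

Lemma antiX p m : anti p -> anti (p ^+ m).
Proof.
by move=> hp; elim: m => [|m IHm]; [exact: anti1 | rewrite expgS; apply: antiM].
Qed.

Hypothesis cc : c * c = 1.

(** With [p ^+ d = (F, c)], squaring gives the translation [F + shift c F = 0] over [c * c = 1]. *)
Lemma anti_exp2 p d : anti p -> p.2 ^+ d = c -> p ^+ (d * 2) = 1.
Proof.
move=> hp pd; have [p1 _] := antiX d hp.
by rewrite expgnA expg2 wreathM wreath_sndX pd p1 addrN cc.
Qed.

Lemma ffun_int_muln_eq0 (F : {ffun G -> int}) m : (0 < m)%N -> (F *+ m = 0 -> F = 0)%R.
Proof.
move=> m0 /ffunP Fm; apply/ffunP => u; have := Fm u.
rewrite ffunMnE !ffunE => /eqP; rewrite Num.Theory.mulrn_eq0.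
by rewrite eqn0Ngt m0 => /eqP.
Qed.

(** Comparing the translations of the two products gives [F = shift c F = - F], and integer
    functions have no 2-torsion. *)
Lemma anti_base_commute F p :
  shift c F = (- F)%R -> p.2 = c -> commute ((F, 1) : wreath G) p -> F = 0%R.
Proof.
move=> Fc pc /(congr1 fst); rewrite /= shift1 pc Fc addrC => /addrI FF.
by apply: (@ffun_int_muln_eq0 _ 2) => //; rewrite mulr2n {1}FF addNr.
Qed.

End AntiInvariant.

Lemma commute_conjX (H : groupType) (h w z : H) m :
  commute h w -> h * z * h^-1 = w * z -> h ^+ m * z * h ^- m = w ^+ m * z.
Proof.
move=> hw hz; elim: m => [|m IHm]; first by rewrite invg1 !mul1g mulg1.
have -> : h ^+ m.+1 * z * h ^- m.+1 = h * (h ^+ m * z * h ^- m) * h^-1.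
  by rewrite expgS invgM !mulgA.
rewrite IHm !mulgA (commuteX m hw) -!mulgA (mulgA h z) hz.
by rewrite mulgA -expgSr.
Qed.

Lemma exists_infinite_order_rank_ge3 n : (2 < n)%N ->
  exists (k0 : nat) (f : aut (freegrp 'I_n)), (0 < k0)%N /\
    forall k m, (k0 %| k)%N -> (0 < m)%N ->
      ~ power_subgroup n k (qproj (Inn (freegrp 'I_n)) (f ^+ m)).
Proof.
move=> n2; have n0 : (0 < n)%N by lia.
have n1 : (1 < n)%N by lia.
have [G [c [d [r0 [d0 c1 cc r0M r0c]]]]] := exists_root_group n0.
pose x i : freegrp 'I_n := fgen i.
pose i0 := Ordinal n0; pose i1 := Ordinal n1; pose i2 := Ordinal n2.
have xS i : range (@fgen 'I_n) (x i) by exists i.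
have x_inj i j : x i = x j -> i = j by case.
have basis := @fgen_free_basis 'I_n.
have r0x i : r0 (x i) ^+ d = c := r0c _ _ basis (xS i).
(* Translation by [c] exchanges the two point masses, which are distinct as [c <> 1]. *)
pose v : {ffun G -> int} := [ffun u : G => (u == 1%g)%:R - (u == c)%:R]%R.
have vc : shift c v = (- v)%R.
  apply/ffunP => u; rewrite !ffunE GRing.opprB.
  by rewrite -!(inj_eq (mulgI c) (c^-1 * u)) !mulVKg mulg1 cc.
have v0 : v <> 0%R.
  move=> /ffunP/(_ 1); rewrite !ffunE eqxx.
  by case: eqP => [/esym/c1|].
have [r [rM rx]] := freegrp_lift
  (fun i => ((if i == i0 then v else 0%R), r0 (x i)) : wreath G).
have r2 w : (r w).2 = r0 w.
  suff e : (fun w => (r w).2) = r0 by rewrite -e.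
  apply: (free_basis_ext basis) => // [u u'|_ [i _ <-]] /=; first by rewrite rM.
  by rewrite rx.
have r_anti w : anti c (r w).
  elim/freegrp_ind: w => [|i|u u' hu hu'|u hu].
  - by rewrite (morph1 rM); apply: anti1.
  - split; last by rewrite r2 -(r0x i); apply/commute_sym/commuteX/commute_refl.
    by rewrite rx /=; case: eqP => _; rewrite ?vc // shift0 GRing.oppr0.
  - by rewrite rM; apply: antiM.
  - by rewrite (morphVg rM); apply: antiV.
have rk k S y : (d * 2 %| k)%N -> free_basis S -> S y -> r y ^+ k = 1.
  case/dvdnP => e -> Sf Sy; rewrite mulnC expgnA (anti_exp2 cc (r_anti y)) ?expg1n //.
  by rewrite r2 (r0c S).
have x20 : x i2 <> x i0 by move/x_inj.
have x21 : x i2 <> x i1 by move/x_inj.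
have [x02 x12] := (nesym x20, nesym x21).
have [t0 t0P] := transvection_exists basis (xS i2) (xS i0) x20.
have [t1 t1P] := transvection_exists basis (xS i2) (xS i1) x21.
have [t02 t0z] := transvectionX d (xS i0) x20 t0P.
have [t12 t1z] := transvectionX d (xS i1) x21 t1P.
(* Both factors map over [c], so [r w] lies over [c * c = 1] and is a pure translation. *)
pose w := x i1 ^+ d * x i0 ^+ d.
pose f := t0 ^+ d * t1 ^+ d.
have f0 : f (x i0) = x i0 by rewrite /f /= t1z ?t0z.
have f1 : f (x i1) = x i1 by rewrite /f /= t1z ?t0z.
have f2 : f (x i2) = w * x i2.
  rewrite /f /= t12 autM (morphXg (@autM _ _)) t0z //.
  by rewrite t02 mulgA.
have fw : f w = w by rewrite autM !(morphXg (@autM _ f)) f0 f1.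
clearbody f.
have fX m : [/\ (f ^+ m) (x i0) = x i0, (f ^+ m) (x i1) = x i1 &
    (f ^+ m) (x i2) = w ^+ m * x i2].
  elim: m => [|m [IH0 IH1 IH2]]; first by rewrite mul1g.
  rewrite expgS; split; rewrite /= ?IH0 ?IH1 ?IH2 //.
  by rewrite autM f2 (morphXg (@autM _ f)) fw mulgA -expgSr.
exists (d * 2)%N, f; split=> [|k m kd m0]; first by rewrite muln_gt0 d0.
case/(power_subgroup_conj rM (fun S y => @rk k S y kd)) => g gE.
set h := r g in gE.
pose A := r (x i0); pose B := r (x i1); pose w' := B ^+ d * A ^+ d.
have rw' : r w = w' by rewrite rM !(morphXg rM).
have [fm0 fm1 fm2] := fX m.
have conjE z : r (g * z * g^-1) = h * r z * h^-1 by rewrite !rM (morphVg rM).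
have hA : commute h A.
  by apply: (mulIg h^-1); rewrite mulgK -conjE -gE fm0.
have hB : commute h B.
  by apply: (mulIg h^-1); rewrite mulgK -conjE -gE fm1.
have hw : commute h w' by apply: commuteM; apply: commuteX.
have hz : h * r (x i2) * h^-1 = w' ^+ m * r (x i2).
  by rewrite -conjE -gE fm2 rM (morphXg rM) rw'.
(* Passing to the power [#|G|] of [h] makes it a pure translation; it commutes with [A ^+ d], which
   lies over [c], and is therefore trivial. *)
have := commute_conjX #|G| (commuteX m hw) hz.
have hG : (h ^+ #|G|).2 = 1.
  by rewrite wreath_sndX -cardsT (@expg_cardG _ [set: G]%G) // inE.
have AE : A ^+ d = ((A ^+ d).1, c).
  by rewrite [LHS]surjective_pairing wreath_sndX r2 r0x.
have hG1 : h ^+ #|G| = 1.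
  rewrite [LHS]surjective_pairing hG; congr pair.
  have [] := antiX #|G| (r_anti g) => h1 _.
  apply: (anti_base_commute h1 (p := A ^+ d)); first by rewrite AE.
  rewrite -hG -surjective_pairing.
  by apply/commute_sym/commuteX/commute_sym/commuteX.
rewrite hG1 invg1 mul1g mulg1 -expgnA => /esym/(canRL (mulgK _)); rewrite mulgV.
have -> : w' = ((- (A ^+ d)%g.1)%R, 1).
  rewrite /w' {1}/B rx /= wreath_topX r0x AE wreathM /= GRing.add0r cc.
  by have [-> _] := antiX d (r_anti (x i0)).
rewrite wreath_baseX => /(congr1 fst) /= /ffun_int_muln_eq0.
rewrite muln_gt0 m0 (cardD1 1) => /(_ isT)/eqP; rewrite GRing.oppr_eq0 => /eqP A0.
(* The translation of [A ^+ d] is now 0, so [A] commutes with [(0, c)]; this yields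
   [v = shift c v = - v], a contradiction. *)
have : A * A ^+ d = A ^+ d * A by rewrite -expgS expgSr.
rewrite AE A0 !wreathM /= shift0 GRing.addr0 GRing.add0r => /(congr1 fst) /=.
rewrite /A rx /= vc => vv; apply: v0.
by apply: (@ffun_int_muln_eq0 _ _ 2) => //; rewrite GRing.mulr2n {1}vv GRing.addNr.
Qed.

(** * Rank two *)

Section Topograph.
Import Order.TTheory GRing.Theory Num.Theory.
Local Open Scope ring_scope.
Implicit Types (a b c : int) (p q : nat) (x y s : int).

(** Subtractive Euclidean algorithm for the value at [p u + q v], given the values [a], [b], [c] at
    [u], [v], [u + v]. One step passes to the basis [(u, u + v)] or [(u + v, v)], and the relation
    supplies the new third value, as in a topograph of Conway. The fuel [p + q] suffices. *)
Fixpoint topo_fuel (k : nat) p q a b c : int :=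
  if k is k'.+1 then
    if p == 0 then if q == 0 then 0 else b else if q == 0 then a else
    if (q <= p)%N then topo_fuel k' (p - q) q a c (a + c - b)
    else topo_fuel k' p (q - p) c b (b + c - a)
  else 0.

Definition topo_nat p q a b c := topo_fuel (p + q) p q a b c.

Lemma topo_fuelE k p q a b c :
  (p + q <= k)%N -> topo_fuel k p q a b c = topo_nat p q a b c.
Proof.
rewrite /topo_nat; have [l] := ubnP (p + q)%N.
elim: l k p q a b c => // l IH [|k] p q a b c lpq kpq.
  by have [-> ->] : p = 0%N /\ q = 0%N by lia.
case: p lpq kpq => [|p] lpq kpq; first by case: q lpq kpq.
case: q lpq kpq => [|q] lpq kpq; first by rewrite addn0.
rewrite addSn /= !subSS; case: ifP => qp.
  by rewrite IH ?[RHS]IH //; lia.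
by rewrite IH ?[RHS]IH //; lia.
Qed.

Lemma topo_nat0r p a b c : (0 < p)%N -> topo_nat p 0 a b c = a.
Proof. by case: p. Qed.

Lemma topo_nat0l q a b c : (0 < q)%N -> topo_nat 0 q a b c = b.
Proof. by case: q. Qed.

Lemma topo_natSS p q a b c : topo_nat p.+1 q.+1 a b c =
  if (q <= p)%N then topo_nat (p - q) q.+1 a c (a + c - b)
  else topo_nat p.+1 (q - p) c b (b + c - a).
Proof.
rewrite {1}/topo_nat addSn /= !subSS ltnS; case: ifP => qp.
  by rewrite topo_fuelE //; lia.
by rewrite topo_fuelE //; lia.
Qed.

Lemma topo_natDl p q a b c :
  topo_nat (p + q) q a b c = topo_nat p q a c (a + c - b).
Proof.
case: q => [|q]; first by case: p => // p; rewrite addn0 !topo_nat0r.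
by rewrite addnS topo_natSS leq_addl addnK.
Qed.

Lemma topo_natDr p q a b c :
  topo_nat p (q + p) a b c = topo_nat p q c b (b + c - a).
Proof.
case: p => [|p]; first by case: q => // q; rewrite addn0 !topo_nat0l.
case: q => [|q].
  (* On the diagonal the recursion takes its other branch; both lead to [c]. *)
  by rewrite add0n -{1}(add0n p.+1) topo_natDl topo_nat0l // topo_nat0r.
by rewrite addnS topo_natSS leqNgt addSn ltnS leq_addl /= -addSn addnK.
Qed.

Lemma topo_natC p q a b c : topo_nat p q a b c = topo_nat q p b a c.
Proof.
have [l] := ubnP (p + q)%N; elim: l p q a b c => // l IH p q a b c lpq.
have [->|q0] := posnP q; first by case: p lpq => // p _; rewrite topo_nat0r // topo_nat0l.
have [->|p0] := posnP p; first by rewrite topo_nat0l // topo_nat0r.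
have [qp|pq] := leqP q p.
  rewrite -(subnK qp) topo_natDl topo_natDr IH //; last by lia.
rewrite -(subnK (ltnW pq)) topo_natDl topo_natDr IH //; last by lia.
Qed.

Lemma topo_nat_edge p q a b c c' :
  (p == 0) || (q == 0) -> topo_nat p q a b c = topo_nat p q a b c'.
Proof.
by case/orP => /eqP->; [case: q | case: p] => // k; rewrite ?topo_nat0l ?topo_nat0r.
Qed.

(* The solution on [Z^2] of [f (u + v) + f (u - v) = f u + f v], for all bases
   [(u, v)], with [f (1, 0) = a], [f (0, 1) = b] and [f (1, 1) = c]. *)
Definition topo x y a b c :=
  topo_nat `|x| `|y| a b (if 0 <= x * y then c else a + b - c).

Lemma topoN x y a b c : topo (- x) (- y) a b c = topo x y a b c.
Proof. by rewrite /topo !abszN mulrNN. Qed.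

(** Negating [v] exchanges the values at [u + v] and [u - v], whose sum is [a + b]. On the axes,
    where [x * y = 0], the third value is never read. *)
Lemma topoNr x y a b c : topo x (- y) a b c = topo x y a b (a + b - c).
Proof.
rewrite /topo abszN mulrN oppr_ge0; have [xy|xy|] := ltrgt0P (x * y).
- by [].
- by congr topo_nat; lia.
move/eqP; rewrite mulf_eq0 => /orP xy; apply: topo_nat_edge.
by case: xy => /eqP->; rewrite ?orbT.
Qed.

Lemma topoNl x y a b c : topo (- x) y a b c = topo x y a b (a + b - c).
Proof. by rewrite -topoN opprK topoNr. Qed.

Lemma topoC x y a b c : topo x y a b c = topo y x b a c.
Proof. by rewrite /topo topo_natC mulrC (addrC a). Qed.

Lemma topo_natE p q a b c : topo p%:Z q%:Z a b c = topo_nat p q a b c.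
Proof. by rewrite /topo mulr_ge0. Qed.

Lemma topoDl x y a b c : topo (x + y) y a b c = topo x y a c (a + c - b).
Proof.
suff topoDl_nat (q : nat) x' a' b' c' :
    topo (x' + q%:Z) q%:Z a' b' c' = topo x' q%:Z a' c' (a' + c' - b').
  case: (lerP 0 y) => [y0|/ltW y0]; first by rewrite -(gez0_abs y0) topoDl_nat.
  by rewrite -topoN opprD -(lez0_abs y0) topoDl_nat (lez0_abs y0) topoN.
case: (lerP 0 x') => [x0|/ltW x0].
  by rewrite -(gez0_abs x0) -PoszD !topo_natE topo_natDl.
have -> : x' = - `|x'|%:Z by lia.
move: `|x'|%N => p {x' x0}; rewrite topoNl.
have -> : a' + c' - (a' + c' - b') = b' by lia.
(* The first coordinate [- p + q] may change sign, and with it the quadrant. *)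
have [pq|/ltnW qp] := leqP p q.
  rewrite -(subnK pq); move: (q - p)%N => r.
  have -> : - p%:Z + (r + p)%N%:Z = r%:Z by lia.
  rewrite !topo_natE topo_natDr addnC topo_natDr topo_natC.
  by congr topo_nat; lia.
have -> : - p%:Z + q%:Z = - (p - q)%N%:Z by lia.
by rewrite topoNl !topo_natE -{2}(subnK qp) topo_natDl; congr topo_nat; lia.
Qed.

Lemma topoDr x y a b c : topo x (y + x) a b c = topo x y c b (b + c - a).
Proof. by rewrite topoC topoDl topoC. Qed.

(** [topoDr] fixes [b] and sends [(a - b, c - b)] to [(c - b, (c - b) - (a - b))], a linear map with
    characteristic polynomial [t^2 - t + 1], hence of order 6. *)
Lemma topoD6 x y s a b c : topo x (y + x * 6 * s) a b c = topo x y a b c.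
Proof.
have step (m : nat) y' : topo x (y' + x * 6 * m%:Z) a b c = topo x y' a b c.
  elim: m => [|m IHm]; first by rewrite mulr0 addr0.
  have -> : y' + x * 6 * m.+1%:Z = y' + x * 6 * m%:Z + x + x + x + x + x + x.
    by rewrite -natr1; ring.
  by rewrite !topoDr -[RHS]IHm; congr topo; lia.
have [s0|s0] := leP 0 s; first by rewrite -(gez0_abs s0) step.
rewrite -(step `|s|%N (y + _)); congr topo.
by rewrite ltz0_abs // mulrN addrK.
Qed.

(** Stability of the family of functions [topo] under the matrix with rows [(x1, x2)] and
    [(y1, y2)]. *)
Definition topo_invariant x1 x2 y1 y2 := forall a b c, exists a' b' c',
  forall p q : int, topo (p * x1 + q * y1) (p * x2 + q * y2) a b c = topo p q a' b' c'.

Lemma topo_invariantC x1 x2 y1 y2 :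
  topo_invariant y1 y2 x1 x2 -> topo_invariant x1 x2 y1 y2.
Proof.
move=> h a b c; have [a' [b' [c' E]]] := h a b c; exists b', a', c' => p q.
by rewrite addrC [p * x2 + _]addrC E topoC.
Qed.

Lemma topo_invariantN x1 x2 y1 y2 :
  topo_invariant (- x1) (- x2) y1 y2 -> topo_invariant x1 x2 y1 y2.
Proof.
move=> h a b c; have [a' [b' [c' E]]] := h a b c; exists a', b', (a' + b' - c') => p q.
by rewrite -topoNl -E !mulrNN.
Qed.

Lemma topo_invariantB x1 x2 y1 y2 :
  topo_invariant (x1 - y1) (x2 - y2) y1 y2 -> topo_invariant x1 x2 y1 y2.
Proof.
move=> h a b c; have [a' [b' [c' E]]] := h a b c.
exists c', b', (b' + c' - a') => p q.
by rewrite -topoDr -E; congr topo; ring.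
Qed.

Lemma topo_invariant_shear s : topo_invariant 1 s 0 1.
Proof.
have shear_nat (m : nat) : topo_invariant 1 m%:Z 0 1.
  elim: m => [|m IHm] a b c.
    by exists a, b, c => p q; congr topo; ring.
  have := @topo_invariantB 1 m.+1%:Z 0 1; rewrite subr0.
  have -> : m.+1%:Z - 1 = m by lia.
  exact.
have [s0|s0] := leP 0 s; first by rewrite -(gez0_abs s0); apply: shear_nat.
move=> a b c; have [a' [b' [c' E]]] := shear_nat `|s|%N a b (a + b - c).
exists a', b', (a' + b' - c') => p q.
have -> : c = a + b - (a + b - c) by lia.
by rewrite -[LHS]topoNr -[RHS]topoNr -E; congr topo; rewrite ?ltz0_abs //; ring.
Qed.

(** Euclid's algorithm on the first column: swaps, sign changes and subtractions of rows keep the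
    determinant up to sign and end, when [y1 = 0], at a shear up to the sign of the second row. *)
Lemma topo_invariant_basis x1 x2 y1 y2 :
  absz (x1 * y2 - x2 * y1)%R = 1%N -> topo_invariant x1 x2 y1 y2.
Proof.
have [l] := ubnP (`|x1| + `|y1|)%N.
elim: l x1 x2 y1 y2 => // l IH.
have IH0 x1 x2 y1 y2 : 0 <= y1 <= x1 -> (`|x1| + `|y1| < l.+1)%N ->
    absz (x1 * y2 - x2 * y1)%R = 1%N -> topo_invariant x1 x2 y1 y2.
  have [->|y10] := eqVneq y1 0; last first.
    move=> yx lxy det; apply/topo_invariantB/IH; first by lia.
    by rewrite -det; congr absz; ring.
  rewrite mulr0 subr0 => x10 _ det.
  have x1E : x1 = 1.
    by move: det; rewrite abszM => /eqP; rewrite muln_eq1 => /andP[/eqP]; lia.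
  have y2E : y2 = 1 \/ y2 = -1 by rewrite x1E mul1r in det; lia.
  rewrite x1E; case: y2E => ->; first exact: topo_invariant_shear.
  apply/topo_invariantC/topo_invariantN/topo_invariantC.
  rewrite oppr0 opprK; exact: topo_invariant_shear.
have IH1 x1 x2 y1 y2 : 0 <= x1 -> 0 <= y1 -> (`|x1| + `|y1| < l.+1)%N ->
    absz (x1 * y2 - x2 * y1)%R = 1%N -> topo_invariant x1 x2 y1 y2.
  move=> x0 y0 lxy det; have [yx|/ltW xy] := leP y1 x1; first by apply: IH0; rewrite ?y0.
  apply/topo_invariantC/IH0; rewrite ?x0 //; first by rewrite addnC.
  by rewrite -det -abszN; congr absz; ring.
have IH2 x1 x2 y1 y2 : 0 <= x1 -> (`|x1| + `|y1| < l.+1)%N ->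
    absz (x1 * y2 - x2 * y1)%R = 1%N -> topo_invariant x1 x2 y1 y2.
  move=> x0 lxy det; have [y0|/ltW y0] := leP 0 y1; first exact: IH1.
  apply/topo_invariantC/topo_invariantN/topo_invariantC/IH1; rewrite ?oppr_ge0 ?abszN //.
  by rewrite -det -abszN; congr absz; ring.
move=> x1 x2 y1 y2 lxy det; have [x0|/ltW x0] := leP 0 x1; first exact: IH2.
apply/topo_invariantN/IH2; rewrite ?oppr_ge0 ?abszN //.
by rewrite -det -abszN; congr absz; ring.
Qed.

End Topograph.

Section IntegerGroup.
Import GRing.Theory.

(** The additive group of the integers, as a target for the universal property of free bases. *)
Definition intg := int.
HB.instance Definition _ := Choice.on intg.
HB.instance Definition _ := isGroup.Build intg
  (@addrA int) (@add0r int) (@addr0 int) (@addNr int) (@addrN int).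


End IntegerGroup.

(** * The action on functions of the abelianisation *)

Section Rank2.
Import GRing.Theory.
Local Open Scope ring_scope.
Local Notation F := (freegrp 'I_2).
Local Notation x0 := (fgen (0 : 'I_2)).
Local Notation x1 := (fgen (1 : 'I_2)).
Local Notation additive_on e := ({morph e : u v / (u * v)%g >-> u + v}).

Lemma additive_onX (e : F -> int) u m :
  additive_on e -> e (u ^+ m)%g = m%:Z * e u.
Proof.
move=> eM; elim: m => [|m IHm].
  by rewrite expg0 mul0r; apply: (addrI (e 1%g)); rewrite -eM mulg1 addr0.
by rewrite expgS eM IHm; lia.
Qed.

Lemma additive_onJ (e : F -> int) g u :
  additive_on e -> e (g * u * g^-1)%g = e u.
Proof.
move=> eM; have := additive_onX 1 0 eM; rewrite expg0 mul0r -(mulgV g).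
by rewrite !eM => gV; rewrite addrAC gV add0r.
Qed.

Lemma additive_on_rank2 (e0 e1 psi : F -> int) (w : F) :
  additive_on e0 -> additive_on e1 -> additive_on psi ->
  e0 x0 = 1 -> e0 x1 = 0 -> e1 x0 = 0 -> e1 x1 = 1 ->
  psi w = e0 w * psi x0 + e1 w * psi x1.
Proof.
move=> e0M e1M psiM e00 e01 e10 e11.
pose chi u := e0 u * psi x0 + e1 u * psi x1.
suff -> : psi w = chi w by [].
suff : psi = chi by move=> {1}->.
apply: (free_basis_ext (H := intg) (@fgen_free_basis 'I_2)) => // [u v|_ [i _ <-]].
  by rewrite -[RHS]/(chi u + chi v) /chi e0M e1M; ring.
have [->|->] : i = 0 \/ i = 1.
  by case: i => [[|[|?]] //= i2]; [left | right]; apply: val_inj.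
- by rewrite /chi e00 e10; ring.
- by rewrite /chi e01 e11; ring.
Qed.

Lemma exists_infinite_order_rank2 :
  exists f : aut F, forall k m, (6 %| k)%N -> (0 < m)%N ->
    ~ power_subgroup 2 k (qproj (Inn F) (f ^+ m)%g).
Proof.
have basis := @fgen_free_basis 'I_2.
have xS i : range (@fgen 'I_2) (fgen i) by exists i.
have lift (h : 'I_2 -> int) : exists e : F -> int,
    additive_on e /\ forall i, e (fgen i) = h i.
  exact: (@freegrp_lift 'I_2 intg).
have [e0 [e0M e0x]] := lift (fun i => (i == 0)%:R).
have [e1 [e1M e1x]] := lift (fun i => (i == 1)%:R).
have coord (psi : F -> int) w :
    additive_on psi -> psi w = e0 w * psi x0 + e1 w * psi x1.
  by move=> psiM; apply: additive_on_rank2; rewrite ?e0x ?e1x.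
(* Pulled back from the abelianisation, these functions are unchanged by inner automorphisms. *)
pose u a b c (w : F) := topo (e0 w) (e1 w) a b c.
have x01 : x0 <> x1 by [].
have [t0 [t0x t0z]] := transvection_exists basis (xS 0) (xS 1) x01.
have [t1 [t1x t1z]] := transvection_exists basis (xS 1) (xS 0) (nesym x01).
exists (t0 * t1)%g; set f := (t0 * t1)%g => k m k6 m0 fP.
have fx0 : f x0 = (x1 * x0)%g by rewrite /= t1z ?t0x.
have fx1 : f x1 = (x1 * x0 * x1)%g.
  by rewrite /= t1x autM t0x t0z //; apply/nesym.
clearbody f; clear t0 t0x t0z t1 t1x t1z.
have addf (e : F -> int) (t : aut F) : additive_on e -> additive_on (e \o t).
  by move=> eM v w; rewrite /= autM eM.
have uf a b c w : u a b c (f w) = u c (b + c - a) (c *+ 2 - a) w.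
  have /= E0 := coord _ w (addf _ f e0M); have /= E1 := coord _ w (addf _ f e1M).
  rewrite /u E0 E1 fx0 fx1.
  rewrite !e0M !e1M !e0x !e1x /=.
  have -> : e0 w * (0 + 1) + e1 w * (0 + 1 + 0) = e0 w + e1 w by ring.
  have -> : e0 w * (1 + 0) + e1 w * (1 + 0 + 1) = e1 w + (e0 w + e1 w) by ring.
  by rewrite topoDr topoDl; congr topo; ring.
(* By [uf], [c - a] is invariant; on the slice [c = a + 1] each application of [f] raises [a] by
   1. *)
have ufX j (s : int) b : exists b', forall w,
    u s b (s + 1) ((f ^+ j)%g w) = u (s + j%:Z) b' (s + j%:Z + 1) w.
  elim: j s b => [|j IHj] s b; first by exists b => w; rewrite addr0.
  have [b' E] := IHj s b; exists (b' + 1) => w.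
  rewrite expgSr /= E uf /u; congr topo; lia.
have inner_u (g : F) (a b c : int) w : u a b c (g * w * g^-1)%g = u a b c w.
  by rewrite /u (additive_onJ _ _ e0M) (additive_onJ _ _ e1M).
pose P : set (Out F) := [set q | exists t : aut F, q = qproj (Inn F) t /\
  forall a b c w, u a b c (t w) = u a b c w].
have Pgrp : is_subgroup P.
  split=> [|_ _ [t [-> tu]] [t' [-> tu']]|_ [t [-> tu]]].
  - by exists 1%g.
  - by exists (t * t')%g; rewrite qprojM; split=> // a b c w; rewrite /= tu tu'.
  - exists t^-1%g; split; first by rewrite (morphVg (@qprojM _ _)).
    by move=> a b c w; rewrite -[in RHS](autKV t w) tu.
have [S x y t Sf Sx Sy xy txy|t [ft tu]] := power_subgroup_ind Pgrp _ fP.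
  exists (t ^+ k)%g; split=> // a b c w.
  have [tx tz] := transvectionX k Sy xy txy.
  (* The functionals dual to [x] and [y] give an integer inverse of the matrix of exponent sums of
     [x] and [y], so its determinant [D] is a sign. *)
  have dual z0 : exists e : F -> int,
      additive_on e /\ forall z, S z -> e z = (z == z0)%:R.
    by have [e [eP _]] := Sf intg (fun z => (z == z0)%:R : int); exists e.
  have [[psi [psiM psiS]] [chi [chiM chiS]]] := (dual x, dual y).
  have /eqP/negPf yx := nesym xy.
  have px : e0 x * psi x0 + e1 x * psi x1 = 1.
    by rewrite -(coord _ _ psiM) psiS // eqxx.
  have py : e0 y * psi x0 + e1 y * psi x1 = 0.
    by rewrite -(coord _ _ psiM) psiS // yx.
  have cx : e0 x * chi x0 + e1 x * chi x1 = 0.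
    by rewrite -(coord _ _ chiM) chiS // eq_sym yx.
  have cy : e0 y * chi x0 + e1 y * chi x1 = 1.
    by rewrite -(coord _ _ chiM) chiS // eqxx.
  set D : int := e0 x * e1 y - e1 x * e0 y.
  have detD : absz D = 1%N.
    have /(congr1 absz) : D * (psi x0 * chi x1 - psi x1 * chi x0) = 1.
      transitivity ((e0 x * psi x0 + e1 x * psi x1) * (e0 y * chi x0 + e1 y * chi x1)
        - (e0 y * psi x0 + e1 y * psi x1) * (e0 x * chi x0 + e1 x * chi x1)).
        by rewrite /D; ring.
      by rewrite px py cx cy.
    by rewrite abszM => /eqP; rewrite muln_eq1 => /andP[/eqP].
  have DD : D * D = 1 by lia.
  (* Cramer's rule for the coordinates of [w] in the basis [(x, y)], with [D] its own inverse. *)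
  pose p : int := D * (e0 w * e1 y - e1 w * e0 y).
  pose q : int := D * (e0 x * e1 w - e1 x * e0 w).
  have w0 : e0 w = p * e0 x + q * e0 y.
    by rewrite -[LHS]mulr1 -DD /p /q /D; ring.
  have w1 : e1 w = p * e1 x + q * e1 y.
    by rewrite -[LHS]mulr1 -DD /p /q /D; ring.
  clearbody p q.
  have eT (e : F -> int) : additive_on e ->
      e ((t ^+ k)%g w) = p * (k%:Z * e y + e x) + q * e y.
    move=> eM; have /= E := fun z => coord _ z (addf _ (t ^+ k)%g eM).
    rewrite -(additive_onX y k eM) -eM -tx -(tz y) //; last exact/nesym.
    by rewrite (E w) (E x) (E y) w0 w1; ring.
  rewrite /u !eT //; case/dvdnP: k6 => s ->.
  have [a' [b' [c' E]]] := topo_invariant_basis detD a b c.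
  (* In these coordinates [t ^+ k] adds [k * p] to [q], a multiple of [6 * p]. *)
  rewrite w0 w1 E -(topoD6 p q s%:Z) -E; congr topo; rewrite PoszM; ring.
have /qproj_eqP[g gE] := esym ft.
(* At [x0], with coordinates [(1, 0)], the function reads its parameter [a]: it is 0 before and [m]
   after applying [f ^+ m], whereas elements of [P] preserve it. *)
have [b' E] := ufX m 0 0.
have := E x0; rewrite add0r -[(f ^+ m)%g x0](autKV t) [X in t X](gE x0) tu inner_u.
rewrite /u e0x e1x (_ : topo _ _ 0 0 1 = 0) // (_ : topo _ _ _ _ _ = m%:Z) ?add0r //.
by move=> /eqP; rewrite eq_sym => /eqP[m00]; rewrite m00 in m0.
Qed.
End Rank2.

(** * All ranks: positive multiples of one exponent *)

Theorem theorem5 (n : nat) (hn : (2 <= n)%N) :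
  exists K : set nat,
    infinite_set K /\
    (forall k : nat, K k -> (0 < k)%N) /\
    (forall k : nat, K k ->
       exists q : quot_grp (power_subgroup n k), infinite_order q).
Proof.
have [k0 [f [k0_gt0 fP]]] : exists (k0 : nat) (f : aut (freegrp 'I_n)),
    (0 < k0)%N /\ forall k m, (k0 %| k)%N -> (0 < m)%N ->
      ~ power_subgroup n k (qproj (Inn (freegrp 'I_n)) (f ^+ m)).
  case: (ltnP 2 n) => [|n2]; first exact: exists_infinite_order_rank_ge3.
  have -> : n = 2 by lia.
  by have [f fP] := exists_infinite_order_rank2; exists 6, f.
exists [set k | (k0 %| k)%N /\ (0 < k)%N]; split; last first.
  split=> [k [] //|k [k0k _]].
  by eexists; apply: infinite_order_qproj => m; apply: fP.
(* This map sends the positive multiples of [k0] onto all natural numbers; the predecessor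
   compensates for the exclusion of 0. *)
move=> /(finite_image (fun k => (k %/ k0).-1)) Kfin; apply: infinite_nat.
apply: sub_finite_set Kfin => m _; exists (m.+1 * k0)%N.
  by split; rewrite ?dvdn_mull // muln_gt0.
by rewrite mulnK.
Qed.
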